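(* Let $T:V\to\mathcal A$ be an anti-super-$\mathcal O$-operator on a noncommutative Hom-Poisson superalgebra $(\mathcal A,[\cdot,\cdot],\mu,\alpha)$ with respect to a representation $(V,\rho,\mathfrak l,\mathfrak r,\beta)$. Define binary operations $\circ_T,\prec_T,\succ_T:V\times V\to V$ on homogeneous elements by $$u\circ_T v=-\rho(T(u))v,\qquad u\prec_T v=-\mathfrak l(T(u))v,\qquad u\succ_T v=-(-1)^{|u||v|}\mathfrak r(T(v))u.$$ Then $(V,\circ_T,\prec_T,\succ_T,\beta)$ is a noncommutative Hom-anti-pre-Poisson superalgebra if and only if $T$ is strong.
   Context: All vector spaces are finite-dimensional over a field $\mathbb F$ of characteristic $0$ and $\mathbb Z_2$-graded; $|x|$ is the degree of a homogeneous element; all structure maps are even; all identities are required for homogeneous elements. Hom-Lie superalgebra $(\mathcal A,[\cdot,\cdot],\alpha)$: $[x,y]=-(-1)^{|x||y|}[y,x]$ and $[\alpha(x),[y,z]]=[[x,y],\alpha(z)]+(-1)^{|x||y|}[\alpha(y),[x,z]]$. Representation $(V,\rho,\beta)$: $\rho(\alpha(x))\beta=\beta\rho(x)$, $\rho([x,y])\beta=\rho(\alpha(x))\rho(y)-(-1)^{|x||y|}\rho(\alpha(y))\rho(x)$. Hom-associative superalgebra $(\mathcal A,\mu,\alpha)$: $\mu(\mu(x,y),\alpha(z))=\mu(\alpha(x),\mu(y,z))$. Representation $(V,\mathfrak l,\mathfrak r,\beta)$: $\beta\mathfrak l(x)=\mathfrak l(\alpha(x))\beta$; $\beta\mathfrak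 r(x)=\mathfrak r(\alpha(x))\beta$; $\mathfrak l(\mu(x,y))\beta=\mathfrak l(\alpha(x))\mathfrak l(y)$; $\mathfrak r(\mu(x,y))\beta=(-1)^{|x||y|}\mathfrak r(\alpha(y))\mathfrak r(x)$; $\mathfrak l(\alpha(x))\mathfrak r(y)=(-1)^{|x||y|}\mathfrak r(\alpha(y))\mathfrak l(x)$. Noncommutative Hom-Poisson superalgebra $(\mathcal A,[\cdot,\cdot],\mu,\alpha)$: $(\mathcal A,[\cdot,\cdot],\alpha)$ is a Hom-Lie superalgebra, $(\mathcal A,\mu,\alpha)$ is a Hom-associative superalgebra, and $[\alpha(x),\mu(y,z)]=\mu([x,y],\alpha(z))+(-1)^{|x||y|}\mu(\alpha(y),[x,z])$. Representation $(V,\rho,\mathfrak l,\mathfrak r,\beta)$: $(V,\rho,\beta)$ is a representation of the Hom-Lie superalgebra, $(V,\mathfrak l,\mathfrak r,\beta)$ is a representation of the Hom-associative superalgebra, and $\mathfrak l([x,y])\beta=\rho(\alpha(x))\mathfrak l(y)-(-1)^{|x||y|}\mathfrak l(\alpha(y))\rho(x)$, $\mathfrak r([x,y])\beta=\rho(\alpha(x))\mathfrak r(y)-(-1)^{|x||y|}\mathfrak r(\alpha(y))\rho(x)$, $\rho(\mu(x,y))\beta=\mathfrak l(\alpha(x))\rho(y)+(-1)^{|x||y|}\mathfrak r(\alpha(y))\rho(x)$. Anti-super-$\mathcal O$-operator: an even linear map $T:V\to\mathcal A$ with $T\circ\beta=\alpha\circ T$, $\mu(T(u),T(v))=-T\big(\mathfrak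 l(T(u))v+(-1)^{|u||v|}\mathfrak r(T(v))u\big)$ and $[T(u),T(v)]=T\big((-1)^{|u||v|}\rho(T(v))u-\rho(T(u))v\big)$. It is strong if for all $u,v,w\in V$: (a) $\rho([T(u),T(v)])\beta(w)+(-1)^{|u|(|v|+|w|)}\rho([T(v),T(w)])\beta(u)+(-1)^{|w|(|u|+|v|)}\rho([T(w),T(u)])\beta(v)=0$; (b) $\mathfrak l(\mu(T(u),T(v)))\beta(w)=(-1)^{|u|(|v|+|w|)}\mathfrak r(\mu(T(v),T(w)))\beta(u)$; (c) $\mathfrak l([T(u),T(v)])\beta(w)+(-1)^{|v||w|}\mathfrak r([T(u),T(w)])\beta(v)+(-1)^{|u|(|v|+|w|)}\rho(\mu(T(v),T(w)))\beta(u)=0$. Hom-anti-pre-Lie superalgebra $(\mathcal A,\circ,\alpha)$: with $[x,y]_\circ=x\circ y-(-1)^{|x||y|}y\circ x$, $\alpha(x)\circ(y\circ z)-(-1)^{|x||y|}\alpha(y)\circ(x\circ z)=(-1)^{|x||y|}[y,x]_\circ\circ\alpha(z)$ and $(-1)^{|x||z|}[x,y]_\circ\circ\alpha(z)+(-1)^{|x||y|}[y,z]_\circ\circ\alpha(x)+(-1)^{|y||z|}[z,x]_\circ\circ\alpha(y)=0$. Hom-anti-dendriform superalgebra $(\mathcal A,\prec,\succ,\alpha)$: with $x\cdot y=x\prec y+x\succ y$, $\alpha(x)\prec(y\prec z)=-(x\cdot y)\prec\alpha(z)=-\alpha(x)\succ(y\cdot z)=(x\succ y)\succ\alpha(z)$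 and $(x\prec y)\succ\alpha(z)=\alpha(x)\prec(y\succ z)$. Noncommutative Hom-anti-pre-Poisson superalgebra $(\mathcal A,\circ,\prec,\succ,\alpha)$: $(\mathcal A,\circ,\alpha)$ is a Hom-anti-pre-Lie superalgebra, $(\mathcal A,\prec,\succ,\alpha)$ is a Hom-anti-dendriform superalgebra, and $(x\circ y-(-1)^{|x||y|}y\circ x)\prec\alpha(z)=-\alpha(x)\circ(y\prec z)+(-1)^{|x||y|}\alpha(y)\prec(x\circ z)$, $\alpha(x)\succ(y\circ z-(-1)^{|y||z|}z\circ y)=-(-1)^{|x||y|}\alpha(y)\circ(x\succ z)+(-1)^{|x||y|}(y\circ x)\succ\alpha(z)$, $(x\prec y+x\succ y)\circ\alpha(z)=-\alpha(x)\prec(y\circ z)-(-1)^{|y||z|}(x\circ z)\succ\alpha(y)$, $\alpha(x)\circ(y\prec z+y\succ z)-(-1)^{|x|(|y|+|z|)}(y\prec z+y\succ z)\circ\alpha(x)-(-1)^{|x||y|}\alpha(y)\prec(x\circ z)-(x\circ y)\succ\alpha(z)=0$. *)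

(* Defs.v *)
From HB Require Import structures.
From mathcomp Require Import all_boot all_order all_algebra.

Set Implicit Arguments.
Unset Strict Implicit.
Unset Printing Implicit Defensive.
Import GRing.Theory.

Local Open Scope ring_scope.
Local Open Scope lfun_scope.

(* The degree group Z_2 is bool: false is 0, true is 1, addition is (+)
   and multiplication is &&.  Thus (-1) ^+ (dx && dy) is (-1)^{|x||y|}.
   The zero vector lies in both components, where every multilinear
   identity holds trivially. *)
Record superSpace (F : fieldType) := SuperSpace {
  sspace :> vectType F;
  grade : bool -> {vspace sspace};
  grade_sum : (grade false + grade true)%VS = fullv;
  grade_cap : (grade false :&: grade true)%VS = 0%VS
}.
Arguments grade {F} s _.

Definition even_map (F : fieldType) (U W : superSpace F) (f : 'Hom(U, W)) :=
  forall d, {in grade U d, forall x, f x \in grade W d}.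

Definition even_bimap (F : fieldType) (U V W : superSpace F)
    (f : 'Hom(U, 'Hom(V, W))) :=
  forall d e,
    {in grade U d & grade V e, forall x y, f x y \in grade W (d (+) e)}.

Record hom_Lie (F : fieldType) (A : superSpace F)
    (br : 'Hom(A, 'End(A))) (alpha : 'End(A)) : Prop := HomLie {
  hlie_even : even_bimap br;
  hlie_twist_even : even_map alpha;
  hlie_skew : forall dx dy, {in grade A dx & grade A dy, forall x y,
    br x y = - ((-1) ^+ (dx && dy) *: br y x)};
  hlie_jacobi : forall dx dy dz,
    {in grade A dx & grade A dy & grade A dz, forall x y z,
    br (alpha x) (br y z)
      = br (br x y) (alpha z) + (-1) ^+ (dx && dy) *: br (alpha y) (br x z)}
}.

Record hom_Lie_rep (F : fieldType) (A V : superSpace F)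
    (br : 'Hom(A, 'End(A))) (alpha : 'End(A))
    (rho : 'Hom(A, 'End(V))) (beta : 'End(V)) : Prop := HomLieRep {
  hlrep_even : even_bimap rho;
  hlrep_twist_even : even_map beta;
  hlrep_twist : forall d, {in grade A d, forall x,
    rho (alpha x) \o beta = beta \o rho x};
  hlrep_br : forall dx dy, {in grade A dx & grade A dy, forall x y,
    rho (br x y) \o beta
      = rho (alpha x) \o rho y
        - (-1) ^+ (dx && dy) *: (rho (alpha y) \o rho x)}
}.

Record hom_assoc (F : fieldType) (A : superSpace F)
    (mu : 'Hom(A, 'End(A))) (alpha : 'End(A)) : Prop := HomAssoc {
  hassoc_even : even_bimap mu;
  hassoc_twist_even : even_map alpha;
  hassoc_assoc : forall dx dy dz,
    {in grade A dx & grade A dy & grade A dz, forall x y z,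
    mu (mu x y) (alpha z) = mu (alpha x) (mu y z)}
}.

Record hom_assoc_rep (F : fieldType) (A V : superSpace F)
    (mu : 'Hom(A, 'End(A))) (alpha : 'End(A))
    (l r : 'Hom(A, 'End(V))) (beta : 'End(V)) : Prop := HomAssocRep {
  harep_l_even : even_bimap l;
  harep_r_even : even_bimap r;
  harep_twist_even : even_map beta;
  harep_twist_l : forall d, {in grade A d, forall x,
    beta \o l x = l (alpha x) \o beta};
  harep_twist_r : forall d, {in grade A d, forall x,
    beta \o r x = r (alpha x) \o beta};
  harep_l : forall dx dy, {in grade A dx & grade A dy, forall x y,
    l (mu x y) \o beta = l (alpha x) \o l y};
  harep_r : forall dx dy, {in grade A dx & grade A dy, forall x y,
    r (mu x y) \o beta = (-1) ^+ (dx && dy) *: (r (alpha y) \o r x)};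
  harep_lr : forall dx dy, {in grade A dx & grade A dy, forall x y,
    l (alpha x) \o r y = (-1) ^+ (dx && dy) *: (r (alpha y) \o l x)}
}.

Record hom_Poisson (F : fieldType) (A : superSpace F)
    (br mu : 'Hom(A, 'End(A))) (alpha : 'End(A)) : Prop := HomPoisson {
  hpois_Lie : hom_Lie br alpha;
  hpois_assoc : hom_assoc mu alpha;
  hpois_leibniz : forall dx dy dz,
    {in grade A dx & grade A dy & grade A dz, forall x y z,
    br (alpha x) (mu y z)
      = mu (br x y) (alpha z) + (-1) ^+ (dx && dy) *: mu (alpha y) (br x z)}
}.

Record hom_Poisson_rep (F : fieldType) (A V : superSpace F)
    (br mu : 'Hom(A, 'End(A))) (alpha : 'End(A))
    (rho l r : 'Hom(A, 'End(V))) (beta : 'End(V)) : Prop := HomPoissonRep {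
  hprep_Lie : hom_Lie_rep br alpha rho beta;
  hprep_assoc : hom_assoc_rep mu alpha l r beta;
  hprep_l : forall dx dy, {in grade A dx & grade A dy, forall x y,
    l (br x y) \o beta
      = rho (alpha x) \o l y - (-1) ^+ (dx && dy) *: (l (alpha y) \o rho x)};
  hprep_r : forall dx dy, {in grade A dx & grade A dy, forall x y,
    r (br x y) \o beta
      = rho (alpha x) \o r y - (-1) ^+ (dx && dy) *: (r (alpha y) \o rho x)};
  hprep_rho : forall dx dy, {in grade A dx & grade A dy, forall x y,
    rho (mu x y) \o beta
      = l (alpha x) \o rho y + (-1) ^+ (dx && dy) *: (r (alpha y) \o rho x)}
}.

Record anti_super_O_operator (F : fieldType) (A V : superSpace F)
    (br mu : 'Hom(A, 'End(A))) (alpha : 'End(A))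
    (rho l r : 'Hom(A, 'End(V))) (beta : 'End(V)) (T : 'Hom(V, A)) : Prop :=
  AntiSuperOOperator {
  asO_even : even_map T;
  asO_twist : T \o beta = alpha \o T;
  asO_mu : forall du dv, {in grade V du & grade V dv, forall u v,
    mu (T u) (T v) = - T (l (T u) v + (-1) ^+ (du && dv) *: r (T v) u)};
  asO_br : forall du dv, {in grade V du & grade V dv, forall u v,
    br (T u) (T v) = T ((-1) ^+ (du && dv) *: rho (T v) u - rho (T u) v)}
}.

Record strong_operator (F : fieldType) (A V : superSpace F)
    (br mu : 'Hom(A, 'End(A))) (rho l r : 'Hom(A, 'End(V)))
    (beta : 'End(V)) (T : 'Hom(V, A)) : Prop := StrongOperator {
  strong_br : forall du dv dw,
    {in grade V du & grade V dv & grade V dw, forall u v w,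
    rho (br (T u) (T v)) (beta w)
    + (-1) ^+ (du && (dv (+) dw)) *: rho (br (T v) (T w)) (beta u)
    + (-1) ^+ (dw && (du (+) dv)) *: rho (br (T w) (T u)) (beta v) = 0};
  strong_mu : forall du dv dw,
    {in grade V du & grade V dv & grade V dw, forall u v w,
    l (mu (T u) (T v)) (beta w)
      = (-1) ^+ (du && (dv (+) dw)) *: r (mu (T v) (T w)) (beta u)};
  strong_br_mu : forall du dv dw,
    {in grade V du & grade V dv & grade V dw, forall u v w,
    l (br (T u) (T v)) (beta w)
    + (-1) ^+ (dv && dw) *: r (br (T u) (T w)) (beta v)
    + (-1) ^+ (du && (dv (+) dw)) *: rho (mu (T v) (T w)) (beta u) = 0}
}.

Definition scomm (F : fieldType) (A : superSpace F) (op : 'Hom(A, 'End(A)))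
    (dx dy : bool) (x y : A) : A :=
  op x y - (-1) ^+ (dx && dy) *: op y x.

Record hom_anti_pre_Lie (F : fieldType) (A : superSpace F)
    (circ : 'Hom(A, 'End(A))) (alpha : 'End(A)) : Prop := HomAntiPreLie {
  hapl_even : even_bimap circ;
  hapl_twist_even : even_map alpha;
  hapl_circ : forall dx dy dz,
    {in grade A dx & grade A dy & grade A dz, forall x y z,
    circ (alpha x) (circ y z)
    - (-1) ^+ (dx && dy) *: circ (alpha y) (circ x z)
      = (-1) ^+ (dx && dy) *: circ (scomm circ dy dx y x) (alpha z)};
  hapl_cyclic : forall dx dy dz,
    {in grade A dx & grade A dy & grade A dz, forall x y z,
    (-1) ^+ (dx && dz) *: circ (scomm circ dx dy x y) (alpha z)
    + (-1) ^+ (dx && dy) *: circ (scomm circ dy dz y z) (alpha x)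
    + (-1) ^+ (dy && dz) *: circ (scomm circ dz dx z x) (alpha y) = 0}
}.

Record hom_anti_dendriform (F : fieldType) (A : superSpace F)
    (prec succ : 'Hom(A, 'End(A))) (alpha : 'End(A)) : Prop :=
  HomAntiDendriform {
  had_prec_even : even_bimap prec;
  had_succ_even : even_bimap succ;
  had_twist_even : even_map alpha;
  had_chain : forall dx dy dz,
    {in grade A dx & grade A dy & grade A dz, forall x y z,
    [/\ prec (alpha x) (prec y z) = - prec (prec x y + succ x y) (alpha z),
        - prec (prec x y + succ x y) (alpha z)
          = - succ (alpha x) (prec y z + succ y z)
      & - succ (alpha x) (prec y z + succ y z)
          = succ (succ x y) (alpha z)]};
  had_mixed : forall dx dy dz,
    {in grade A dx & grade A dy & grade A dz, forall x y z,
    succ (prec x y) (alpha z) = prec (alpha x) (succ y z)}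
}.

Record hom_anti_pre_Poisson (F : fieldType) (A : superSpace F)
    (circ prec succ : 'Hom(A, 'End(A))) (alpha : 'End(A)) : Prop :=
  HomAntiPrePoisson {
  happ_Lie : hom_anti_pre_Lie circ alpha;
  happ_dendriform : hom_anti_dendriform prec succ alpha;
  happ_comm_prec : forall dx dy dz,
    {in grade A dx & grade A dy & grade A dz, forall x y z,
    prec (circ x y - (-1) ^+ (dx && dy) *: circ y x) (alpha z)
      = - circ (alpha x) (prec y z)
        + (-1) ^+ (dx && dy) *: prec (alpha y) (circ x z)};
  happ_succ_comm : forall dx dy dz,
    {in grade A dx & grade A dy & grade A dz, forall x y z,
    succ (alpha x) (circ y z - (-1) ^+ (dy && dz) *: circ z y)
      = - ((-1) ^+ (dx && dy) *: circ (alpha y) (succ x z))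
        + (-1) ^+ (dx && dy) *: succ (circ y x) (alpha z)};
  happ_mul_circ : forall dx dy dz,
    {in grade A dx & grade A dy & grade A dz, forall x y z,
    circ (prec x y + succ x y) (alpha z)
      = - prec (alpha x) (circ y z)
        - (-1) ^+ (dy && dz) *: succ (circ x z) (alpha y)};
  happ_circ_mul : forall dx dy dz,
    {in grade A dx & grade A dy & grade A dz, forall x y z,
    circ (alpha x) (prec y z + succ y z)
    - (-1) ^+ (dx && (dy (+) dz)) *: circ (prec y z + succ y z) (alpha x)
    - (-1) ^+ (dx && dy) *: prec (alpha y) (circ x z)
    - succ (circ x y) (alpha z) = 0}
}.

Definition bilin (F : fieldType) (U V W : vectType F) (f : U -> V -> W) :
  'Hom(U, 'Hom(V, W)) := linfun (fun u => linfun (f u)).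

Definition sproj (F : fieldType) (V : superSpace F) (d : bool) : 'End(V) :=
  daddv_pi (grade V d) (grade V (~~ d)).

Definition circT (F : fieldType) (A V : superSpace F)
    (rho : 'Hom(A, 'End(V))) (T : 'Hom(V, A)) : 'Hom(V, 'End(V)) :=
  bilin (fun u v => - rho (T u) v).

Definition precT (F : fieldType) (A V : superSpace F)
    (l : 'Hom(A, 'End(V))) (T : 'Hom(V, A)) : 'Hom(V, 'End(V)) :=
  bilin (fun u v => - l (T u) v).

(* The bilinear extension of (u, v) |-> - (-1)^{|u||v|} r(T v) u from
   homogeneous vectors to all of V; see succTE. *)
Definition succT (F : fieldType) (A V : superSpace F)
    (r : 'Hom(A, 'End(V))) (T : 'Hom(V, A)) : 'Hom(V, 'End(V)) :=
  bilin (fun u v => \sum_(d : bool) \sum_(e : bool)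
    - ((-1) ^+ (d && e) *: r (T (sproj V e v)) (sproj V d u))).

Lemma bilinE (F : fieldType) (U V W : vectType F) (f : U -> V -> W) :
  (forall v, linear (f^~ v)) -> (forall u, linear (f u)) ->
  forall u v, bilin f u v = f u v.
Proof.
move=> fl fr u v.
have linE (X Y : vectType F) (g : X -> Y) : linear g -> linfun g =1 g.
  move=> g_lin; pose gM := GRing.isLinear.Build F X Y _ g g_lin.
  pose gL : {linear X -> Y} := HB.pack g gM.
  exact: (lfunE gL).
rewrite /bilin linE; first by rewrite linE.
move=> a x y; apply/lfunP=> w.
by rewrite add_lfunE scale_lfunE !linE // fl.
Qed.

Lemma circTE (F : fieldType) (A V : superSpace F)
    (rho : 'Hom(A, 'End(V))) (T : 'Hom(V, A)) (u v : V) :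
  circT rho T u v = - rho (T u) v.
Proof.
rewrite /circT bilinE // => [w | w] a x y.
  by rewrite !linearP add_lfunE scale_lfunE opprD scalerN.
by rewrite linearP opprD scalerN.
Qed.

Lemma precTE (F : fieldType) (A V : superSpace F)
    (l : 'Hom(A, 'End(V))) (T : 'Hom(V, A)) (u v : V) :
  precT l T u v = - l (T u) v.
Proof. exact: circTE. Qed.

Lemma sproj_id (F : fieldType) (V : superSpace F) d :
  {in grade V d, forall u, sproj V d u = u}.
Proof.
move=> u ud; rewrite /sproj daddv_pi_id //.
by case: d {ud} => /=; [rewrite capvC |]; exact: grade_cap.
Qed.

Lemma sproj_neq (F : fieldType) (V : superSpace F) d :
  {in grade V d, forall u, sproj V (~~ d) u = 0}.
Proof.
move=> u ud; have cap0 : (grade V d :&: grade V (~~ d))%VS = 0%VS.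
  by case: d {ud} => /=; [rewrite capvC |]; exact: grade_cap.
have uS : u \in (grade V d + grade V (~~ d))%VS.
  by apply: (subvP (addvSl _ _)).
have := daddv_pi_add cap0 uS; rewrite daddv_pi_id // /sproj negbK => /eqP.
by rewrite -subr_eq0 addrAC subrr add0r => /eqP.
Qed.

Lemma succTE (F : fieldType) (A V : superSpace F)
    (r : 'Hom(A, 'End(V))) (T : 'Hom(V, A)) (du dv : bool) :
  {in grade V du & grade V dv, forall u v,
    succT r T u v = - ((-1) ^+ (du && dv) *: r (T v) u)}.
Proof.
move=> u v uV vV; rewrite /succT bilinE; last first.
- move=> {uV vV v}u a x y; rewrite scaler_sumr -big_split /=.
  apply: eq_bigr => d _; rewrite scaler_sumr -big_split /=.
  apply: eq_bigr => e _.
  rewrite !linearP add_lfunE scale_lfunE scalerDr opprD !scalerN !scalerA.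
  by rewrite mulrC.
- move=> {uV vV u}v a x y; rewrite scaler_sumr -big_split /=.
  apply: eq_bigr => d _; rewrite scaler_sumr -big_split /=.
  apply: eq_bigr => e _.
  by rewrite !linearP.
have projE d w : w \in grade V d -> forall e, sproj V e w = (e == d)%:R *: w.
  move=> wd e; have [-> | ] := eqVneq e d; first by rewrite scale1r sproj_id.
  move=> ned; have -> : e = ~~ d by case: e d ned {wd} => [] [].
  by rewrite sproj_neq // scale0r.
rewrite !big_bool /= !(projE _ _ uV) !(projE _ _ vV).
by case: du dv {uV vV projE} => [] [] /=;
  rewrite ?scale1r ?scale0r ?linear0 ?lfunE /= ?scaler0 ?oppr0 ?addr0 ?add0r.
Qed.

(* Main.v *)
Require Import Defs.
From mathcomp Require Import all_boot all_order all_algebra.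

Local Open Scope ring_scope.

Import GRing.Theory.

(** On V the super-commutator of [circT] and the sum of [precT] and [succT]
    are exactly the products that T carries to the bracket and the
    multiplication of A ([T_scomm], [T_prec_succ]): this is what the defining
    identities of an anti-super-O-operator say.  The relation
    T beta = alpha T turns a twist on V into one on A.

    Substituting this in the axioms of a noncommutative Hom-anti-pre-Poisson
    superalgebra turns each side of each axiom into a combination of operators
    of two sorts: composites such as rho(alpha(T u)) l(T v), and actions of a
    product, such as l([T u, T v]) beta.  The representation identities trade
    one sort for the other.  Most axioms are then instances of a representation
    identity and hold for every anti-super-O-operator.  What remains is three
    statements about actions of products in which the twist
    beta falls on different vectors, so that no representation identity
    relates their terms; these are the three conditions of strength:
    - the cyclic identity of [circT] is, up to the sign
      -(-1)^{|u||w|}, the condition on rho([T u, T v]) ([circT_cyclic]);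
    - the anti-dendriform chain of four equal terms has its first two terms
      equal to l(mu(T u, T v)) beta w and its last two equal to
      +-r(mu(T v, T w)) beta u, so its middle equality is the condition on
      l and r ([precT_precT], [precT_mul], [succT_mul], [succT_succT]);
    - the last compatibility is the mixed condition, term for term
      ([circT_mul_defect]).

    Strength is thus recovered from three of the axioms, and conversely gives
    precisely those that the representation identities leave open. *)

(** * Parity and linearity *)

Lemma circT_even {F : fieldType} {A V : superSpace F}
    {rho : 'Hom(A, 'End(V))} {T : 'Hom(V, A)} :
  even_map T -> even_bimap rho -> even_bimap (circT rho T).
Proof.
move=> T_even rho_even d e u v uV vV.
by rewrite circTE rpredN rho_even ?T_even.
Qed.

Lemma precT_even {F : fieldType} {A V : superSpace F}
    {l : 'Hom(A, 'End(V))} {T : 'Hom(V, A)} :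
  even_map T -> even_bimap l -> even_bimap (precT l T).
Proof.
move=> T_even l_even d e u v uV vV.
by rewrite precTE rpredN l_even ?T_even.
Qed.

Lemma succT_even {F : fieldType} {A V : superSpace F}
    {r : 'Hom(A, 'End(V))} {T : 'Hom(V, A)} :
  even_map T -> even_bimap r -> even_bimap (succT r T).
Proof.
move=> T_even r_even d e u v uV vV; rewrite (succTE _ _ uV vV) rpredN rpredZ //.
by rewrite addbC r_even ?T_even.
Qed.

(** The additivity rules below mention application of a linear map syntactically,
    which spares rewriting the search for a linear structure at every
    function application. *)
Lemma lfunN {F : fieldType} {U W : vectType F} (f : 'Hom(U, W)) x :
  f (- x) = - f x.
Proof. exact: linearN. Qed.

Lemma lfunD {F : fieldType} {U W : vectType F} (f : 'Hom(U, W)) x y :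
  f (x + y) = f x + f y.
Proof. exact: linearD. Qed.

Lemma lfunZ {F : fieldType} {U W : vectType F} (f : 'Hom(U, W)) a x :
  f (a *: x) = a *: f x.
Proof. exact: linearZ. Qed.

(* Applying a linear map is defined by matrix multiplication; keeping it folded
   stops conversion from comparing two applications through their matrices. *)
Local Opaque fun_of_lfun.

Section InducedOperations.

Context {F : fieldType} {A V : superSpace F} {br mu : 'Hom(A, 'End(A))}
  {alpha : 'End(A)} {rho l r : 'Hom(A, 'End(V))} {beta : 'End(V)}
  {T : 'Hom(V, A)}.

Hypothesis hV : hom_Poisson_rep br mu alpha rho l r beta.
Hypothesis hT : anti_super_O_operator br mu alpha rho l r beta T.

(** * The operator T intertwines the induced products with those of A *)

Lemma T_mem {d u} : u \in grade V d -> T u \in grade A d.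
Proof. exact: (asO_even hT). Qed.

Lemma T_twist u : T (beta u) = alpha (T u).
Proof. by rewrite -!comp_lfunE (asO_twist hT). Qed.

Lemma beta_mem {d u} : u \in grade V d -> beta u \in grade V d.
Proof. exact: (hlrep_twist_even (hprep_Lie hV)). Qed.

Lemma precT_mem {d e u v} : u \in grade V d -> v \in grade V e ->
  precT l T u v \in grade V (d (+) e).
Proof.
move=> uV vV.
exact: (precT_even (asO_even hT) (harep_l_even (hprep_assoc hV)) d e u v uV vV).
Qed.

Lemma succT_mem {d e u v} : u \in grade V d -> v \in grade V e ->
  succT r T u v \in grade V (d (+) e).
Proof.
move=> uV vV.
exact: (succT_even (asO_even hT) (harep_r_even (hprep_assoc hV)) d e u v uV vV).
Qed.

Lemma circT_mem {d e u v} : u \in grade V d -> v \in grade V e ->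
  circT rho T u v \in grade V (d (+) e).
Proof.
move=> uV vV.
exact: (circT_even (asO_even hT) (hlrep_even (hprep_Lie hV)) d e u v uV vV).
Qed.

(** The bracket identity of T reads [T u, T v] = T(-rho(T u) v + ...): the minus
    sign in [circT] absorbs the one that makes the operator `anti'. *)
Lemma T_scomm {du dv u v} : u \in grade V du -> v \in grade V dv ->
  T (circT rho T u v - (-1) ^+ (du && dv) *: circT rho T v u) = br (T u) (T v).
Proof.
by move=> uV vV; rewrite (asO_br hT uV vV) !circTE scalerN opprK addrC.
Qed.

Lemma T_prec_succ {du dv u v} : u \in grade V du -> v \in grade V dv ->
  T (precT l T u v + succT r T u v) = mu (T u) (T v).
Proof.
move=> uV vV.
by rewrite (asO_mu hT uV vV) precTE (succTE _ _ uV vV) -opprD lfunN.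
Qed.

(** * Representation identities along T *)

Lemma rho_brT {du dv u v} w : u \in grade V du -> v \in grade V dv ->
  rho (br (T u) (T v)) (beta w)
    = rho (alpha (T u)) (rho (T v) w)
      - (-1) ^+ (du && dv) *: rho (alpha (T v)) (rho (T u) w).
Proof.
move=> /T_mem uA /T_mem vA.
have /lfunP/(_ w) := hlrep_br (hprep_Lie hV) uA vA.
by rewrite !lfun_simp.
Qed.

Lemma l_muT {du dv u v} w : u \in grade V du -> v \in grade V dv ->
  l (mu (T u) (T v)) (beta w) = l (alpha (T u)) (l (T v) w).
Proof.
move=> /T_mem uA /T_mem vA.
have /lfunP/(_ w) := harep_l (hprep_assoc hV) uA vA.
by rewrite !lfun_simp.
Qed.

Lemma r_muT {du dv u v} w : u \in grade V du -> v \in grade V dv ->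
  r (mu (T u) (T v)) (beta w)
    = (-1) ^+ (du && dv) *: r (alpha (T v)) (r (T u) w).
Proof.
move=> /T_mem uA /T_mem vA.
have /lfunP/(_ w) := harep_r (hprep_assoc hV) uA vA.
by rewrite !lfun_simp.
Qed.

Lemma l_rT {du dv u v} w : u \in grade V du -> v \in grade V dv ->
  l (alpha (T u)) (r (T v) w)
    = (-1) ^+ (du && dv) *: r (alpha (T v)) (l (T u) w).
Proof.
move=> /T_mem uA /T_mem vA.
have /lfunP/(_ w) := harep_lr (hprep_assoc hV) uA vA.
by rewrite !lfun_simp.
Qed.

Lemma l_brT {du dv u v} w : u \in grade V du -> v \in grade V dv ->
  l (br (T u) (T v)) (beta w)
    = rho (alpha (T u)) (l (T v) w)
      - (-1) ^+ (du && dv) *: l (alpha (T v)) (rho (T u) w).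
Proof.
move=> /T_mem uA /T_mem vA; have /lfunP/(_ w) := hprep_l hV uA vA.
by rewrite !lfun_simp.
Qed.

Lemma r_brT {du dv u v} w : u \in grade V du -> v \in grade V dv ->
  r (br (T u) (T v)) (beta w)
    = rho (alpha (T u)) (r (T v) w)
      - (-1) ^+ (du && dv) *: r (alpha (T v)) (rho (T u) w).
Proof.
move=> /T_mem uA /T_mem vA; have /lfunP/(_ w) := hprep_r hV uA vA.
by rewrite !lfun_simp.
Qed.

Lemma rho_muT {du dv u v} w : u \in grade V du -> v \in grade V dv ->
  rho (mu (T u) (T v)) (beta w)
    = l (alpha (T u)) (rho (T v) w)
      + (-1) ^+ (du && dv) *: r (alpha (T v)) (rho (T u) w).
Proof.
move=> /T_mem uA /T_mem vA; have /lfunP/(_ w) := hprep_rho hV uA vA.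
by rewrite !lfun_simp.
Qed.

(** * The anti-pre-Poisson axioms, computed in the representation *)

Context {du dv dw : bool} {u v w : V}.
Hypotheses (uV : u \in grade V du) (vV : v \in grade V dv)
  (wV : w \in grade V dw).

Lemma circT_circ :
  circT rho T (beta u) (circT rho T v w)
  - (-1) ^+ (du && dv) *: circT rho T (beta v) (circT rho T u w)
    = (-1) ^+ (du && dv)
        *: circT rho T (scomm (circT rho T) dv du v u) (beta w).
Proof.
rewrite ![circT _ _ _ _ in RHS]circTE.
rewrite /scomm.
rewrite (T_scomm vV uV).
rewrite (rho_brT _ vV uV).
rewrite !circTE !T_twist !lfunN !opprK.
by rewrite andbC opprB scalerBr scalerA -signr_addb addbb scale1r.
Qed.

(** Multiplying the strength condition by (-1)^{|u||w|} makes its signs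
    cyclically symmetric: (-1)^{|u|(|v|+|w|)} becomes (-1)^{|u||v|} and
    (-1)^{|w|(|u|+|v|)} becomes (-1)^{|v||w|}. *)
Lemma circT_cyclic :
  (-1) ^+ (du && dw) *: circT rho T (scomm (circT rho T) du dv u v) (beta w)
  + (-1) ^+ (du && dv) *: circT rho T (scomm (circT rho T) dv dw v w) (beta u)
  + (-1) ^+ (dv && dw) *: circT rho T (scomm (circT rho T) dw du w u) (beta v)
    = - ((-1) ^+ (du && dw) *:
      (rho (br (T u) (T v)) (beta w)
       + (-1) ^+ (du && (dv (+) dw)) *: rho (br (T v) (T w)) (beta u)
       + (-1) ^+ (dw && (du (+) dv)) *: rho (br (T w) (T u)) (beta v))).
Proof.
rewrite /scomm ![circT _ _ (_ - _) _]circTE.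
rewrite (T_scomm uV vV) (T_scomm vV wV) (T_scomm wV uV).
rewrite !scalerDr !scalerA -!signr_addb !scalerN !opprD.
by case: (du) (dv) (dw) => [] [] [].
Qed.

(** [precT_precT] and [precT_mul] evaluate the first half of the anti-dendriform
    chain to the action of T u, T v on w; [succT_mul] and [succT_succT] evaluate
    the second half to the action of T v, T w on u. *)
Lemma precT_precT :
  precT l T (beta u) (precT l T v w) = l (mu (T u) (T v)) (beta w).
Proof. by rewrite (l_muT _ uV vV) !precTE lfunN opprK T_twist. Qed.

Lemma precT_mul :
  - precT l T (precT l T u v + succT r T u v) (beta w)
    = l (mu (T u) (T v)) (beta w).
Proof. by rewrite precTE opprK (T_prec_succ uV vV). Qed.

Lemma succT_mul :
  - succT r T (beta u) (precT l T v w + succT r T v w)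
    = (-1) ^+ (du && (dv (+) dw)) *: r (mu (T v) (T w)) (beta u).
Proof.
have vwV : precT l T v w + succT r T v w \in grade V (dv (+) dw).
  by rewrite rpredD ?precT_mem ?succT_mem.
rewrite (succTE _ _ (beta_mem uV) vwV) opprK.
by rewrite (T_prec_succ vV wV).
Qed.

Lemma succT_succT :
  succT r T (succT r T u v) (beta w)
    = (-1) ^+ (du && (dv (+) dw)) *: r (mu (T v) (T w)) (beta u).
Proof.
rewrite (succTE _ _ (succT_mem uV vV) (beta_mem wV)).
rewrite (succTE _ _ uV vV) (r_muT _ vV wV) T_twist.
rewrite lfunN lfunZ scalerN opprK !scalerA -!signr_addb.
by case: (du) (dv) (dw) => [] [] [].
Qed.

(** This axiom only expresses that left and right actions commute up to sign. *)
Lemma succT_precT :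
  succT r T (precT l T u v) (beta w) = precT l T (beta u) (succT r T v w).
Proof.
rewrite (succTE _ _ (precT_mem uV vV) (beta_mem wV)) !precTE.
rewrite (succTE _ _ vV wV) !T_twist !lfunN !lfunZ (l_rT _ uV wV).
rewrite scalerN !opprK scalerA -signr_addb.
by case: (du) (dv) (dw) => [] [] [].
Qed.

Lemma precT_scomm :
  precT l T (circT rho T u v - (-1) ^+ (du && dv) *: circT rho T v u) (beta w)
    = - circT rho T (beta u) (precT l T v w)
      + (-1) ^+ (du && dv) *: precT l T (beta v) (circT rho T u w).
Proof.
rewrite [LHS]precTE (T_scomm uV vV) (l_brT _ uV vV).
by rewrite !(circTE, precTE) !T_twist !lfunN !opprK opprB addrC.
Qed.

Lemma succT_scomm :
  succT r T (beta u) (circT rho T v w - (-1) ^+ (dv && dw) *: circT rho T w v)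
    = - ((-1) ^+ (du && dv) *: circT rho T (beta v) (succT r T u w))
      + (-1) ^+ (du && dv) *: succT r T (circT rho T v u) (beta w).
Proof.
have vwV : circT rho T v w - (-1) ^+ (dv && dw) *: circT rho T w v
    \in grade V (dv (+) dw).
  apply: rpredB; first exact: circT_mem.
  by apply: rpredZ; rewrite addbC; apply: circT_mem.
rewrite (succTE _ _ (beta_mem uV) vwV) (T_scomm vV wV).
rewrite (succTE _ _ (circT_mem vV uV) (beta_mem wV)).
rewrite (r_brT _ vV wV) !circTE (succTE _ _ uV wV) !T_twist.
rewrite !lfunN !lfunZ !scalerN !opprK scalerBr opprB.
rewrite !scalerA -!signr_addb addrC.
by case: (du) (dv) (dw) => [] [] [].
Qed.

Lemma circT_mul :
  circT rho T (precT l T u v + succT r T u v) (beta w)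
    = - precT l T (beta u) (circT rho T v w)
      - (-1) ^+ (dv && dw) *: succT r T (circT rho T u w) (beta v).
Proof.
rewrite [LHS]circTE (T_prec_succ uV vV) (rho_muT _ uV vV).
rewrite (succTE _ _ (circT_mem uV wV) (beta_mem vV)) precTE !circTE !T_twist.
rewrite !lfunN !scalerN !opprK opprD scalerA -signr_addb.
by case: (du) (dv) (dw) => [] [] [].
Qed.

(** Expanding l([T u, T v]) beta and r([T u, T w]) beta each gives a composite
    starting with rho(alpha(T u)), and together they
    are the [circT]-product of beta u with the product of v and w; the term rho(mu(T v, T w)) beta u
    comes from the reversed product and stays unexpanded. *)
Lemma circT_mul_defect :
  circT rho T (beta u) (precT l T v w + succT r T v w)
  - (-1) ^+ (du && (dv (+) dw))
      *: circT rho T (precT l T v w + succT r T v w) (beta u)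
  - (-1) ^+ (du && dv) *: precT l T (beta v) (circT rho T u w)
  - succT r T (circT rho T u v) (beta w)
    = l (br (T u) (T v)) (beta w)
      + (-1) ^+ (dv && dw) *: r (br (T u) (T w)) (beta v)
      + (-1) ^+ (du && (dv (+) dw)) *: rho (mu (T v) (T w)) (beta u).
Proof.
rewrite [circT _ _ (_ + _) _]circTE (T_prec_succ vV wV).
rewrite (succTE _ _ (circT_mem uV vV) (beta_mem wV)).
rewrite !(circTE, precTE) (succTE _ _ vV wV) !T_twist.
rewrite (l_brT _ uV vV) (r_brT _ uV wV).
rewrite !(lfunN, lfunD, lfunZ, scalerN) opprD !opprK scalerBr scalerA -signr_addb.
(* The five summands on the left are, in order: rho l, rho r, rho(mu), l rho
   and r rho; the third is the one that stays unexpanded. *)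
by rewrite [LHS](ACl ((1 * 4) * (2 * 5) * 3))%AC andb_addl (addbC (du && dw)).
Qed.

End InducedOperations.

Theorem theorem4p2 (F : fieldType) (charF0 : [pchar F] =i pred0)
    (A V : superSpace F)
    (br mu : 'Hom(A, 'End(A))) (alpha : 'End(A))
    (rho l r : 'Hom(A, 'End(V))) (beta : 'End(V)) (T : 'Hom(V, A))
    (hA : hom_Poisson br mu alpha)
    (hV : hom_Poisson_rep br mu alpha rho l r beta)
    (hT : anti_super_O_operator br mu alpha rho l r beta T) :
  hom_anti_pre_Poisson (circT rho T) (precT l T) (succT r T) beta
  <-> strong_operator br mu rho l r beta T.
Proof.
split=> [[[_ _ _ cyc] [_ _ _ chain _] _ _ _ defect] | [sbr smu sbm]].
  split=> du dv dw u v w uV vV wV.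
  - move/eqP: (cyc _ _ _ _ _ _ uV vV wV).
    by rewrite (circT_cyclic hT uV vV wV) oppr_eq0 scaler_eq0 signr_eq0 => /eqP.
  - have [_ + _] := chain _ _ _ _ _ _ uV vV wV.
    by rewrite (precT_mul hT uV vV) (succT_mul hV hT uV vV wV).
  - by rewrite -(circT_mul_defect hV hT uV vV wV); apply: defect.
have T_even := asO_even hT; have [hL hAs _ _ _] := hV.
have beta_even := hlrep_twist_even hL.
split.
- split=> //; first exact: (circT_even T_even (hlrep_even hL)).
    by move=> du dv _ u v w uV vV _; apply: (circT_circ hV hT uV vV).
  move=> du dv dw u v w uV vV wV.
  by rewrite (circT_cyclic hT uV vV wV) (sbr _ _ _ _ _ _ uV vV wV) scaler0 oppr0.
- split=> //.
  + exact: (precT_even T_even (harep_l_even hAs)).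
  + exact: (succT_even T_even (harep_r_even hAs)).
  + move=> du dv dw u v w uV vV wV.
    rewrite (precT_precT hV hT uV vV) (precT_mul hT uV vV).
    rewrite (succT_mul hV hT uV vV wV) (succT_succT hV hT uV vV wV).
    by split=> //; apply: smu.
  + by move=> du dv dw u v w uV vV wV; apply: (succT_precT hV hT uV vV wV).
- by move=> du dv dw u v w uV vV wV; apply: (precT_scomm hV hT uV vV).
- by move=> du dv dw u v w uV vV wV; apply: (succT_scomm hV hT uV vV wV).
- by move=> du dv dw u v w uV vV wV; apply: (circT_mul hV hT uV vV wV).
- move=> du dv dw u v w uV vV wV.
  by rewrite (circT_mul_defect hV hT uV vV wV); apply: sbm.
Qed.
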